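(* Let $\pi^-$ be the inverse of $\pi\in IP(n,k)$, with characteristic function $\varphi^-$. Then the corresponding idempotent map $\iota\in I(n,k)$ can be determined from $\pi^-$ in $\mathcal{O}(n)$ time by $$\iota(\pi^-(i))=\begin{cases}\pi^-(i)&\text{if }\varphi^-(i)=1,\\ \iota(\pi^-(i-1))&\text{otherwise},\end{cases}\qquad i=1,2,\ldots,n.$$
   Context: $[n]=\{1,\ldots,n\}$. $I(n,k)$ is the set of idempotent maps $\iota:[n]\to[n]$ ($\iota(\iota(x))=\iota(x)$ for all $x$) with image of cardinality $k$. An idempotent permutation of degree $k$ ($1\le k\le n$) is a permutation $\pi$ of $[n]$ together with a distinguished set of indices $A=\{a_1<\cdots<a_k\}\subseteq[n]$ such that the values $c_i=\pi(a_i)$ satisfy $1=c_1<c_2<\cdots<c_k$; put $c_{k+1}=n+1$ and $[a_i]_\pi=\{x\in[n]:c_i\le\pi(x)<c_{i+1}\}$. $IP(n,k)$ denotes the set of idempotent permutations of degree $k$. The idempotent map corresponding to $\pi$ is the map $\iota\in I(n,k)$ with $\iota(x)=a_i$ for all $x\in[a_i]_\pi$, $i=1,\ldots,k$. $\pi^-$ is the inverse permutation, and $\varphi^-:[n]\to\{0,1\}$ is given by $\varphi^-(x)=1$ if $x\in\{c_1,\ldots,c_k\}$ and $0$ otherwise (in particular $\varphi^-(1)=1$). The formula is evaluated successively for $i=1,2,\ldots,n$. Time is on a unit-cost random access machine. *)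

(* Defs.v *)
From HB Require Import structures.
From mathcomp Require Import all_boot all_order all_fingroup.

Set Implicit Arguments.
Unset Strict Implicit.
Unset Printing Implicit Defensive.

(** The set [n] = {1, ..., n} is modelled by ['I_n] = {0, ..., n.-1}: the ordinal
    of value [j] stands for [j.+1].  So "c_1 = 1" reads "c_1 is 0", and
    "c_(k+1) = n + 1" reads "c_(k+1) is n". *)

(** * Idempotent maps and idempotent permutations *)

Definition idem_maps (n k : nat) : {set {ffun 'I_n -> 'I_n}} :=
  [set f : {ffun 'I_n -> 'I_n} |
    [forall x, f (f x) == f x] && (#|[set f x | x in 'I_n]| == k)].

(** [enum A] lists a set of ordinals in increasing order: this is a_1 < ... < a_k,
    and [cvals pi A] is the list c_1, ..., c_k. *)
Definition cvals (n : nat) (pi : 'S_n) (A : {set 'I_n}) : seq nat :=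
  [seq val (pi a) | a <- enum A].

Record idem_perm (n k : nat) := IdemPerm {
  ip_perm : 'S_n;
  ip_set : {set 'I_n};
  ip_deg : 0 < k <= n;
  ip_card : #|ip_set| = k;
  ip_first : nth n (cvals ip_perm ip_set) 0 = 0;
  ip_incr : sorted ltn (cvals ip_perm ip_set)
}.

Section IdemPerm.
Variables (n k : nat) (p : idem_perm n k).

(** [cval i] is c_(i+1).  Since [cvals] has length k, the default value gives
    [cval k = n], the convention for c_(k+1). *)
Definition cval (i : nat) : nat := nth n (cvals (ip_perm p) (ip_set p)) i.

(** The class of a_(i+1). *)
Definition block (i : nat) : {set 'I_n} :=
  [set x | cval i <= ip_perm p x < cval i.+1].

(** The default branch is never taken: see [block_cover] and [idem_mapE]. *)
Definition idem_map : {ffun 'I_n -> 'I_n} :=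
  [ffun x => if [pick i : 'I_k | x \in block i] is Some i
             then nth x (enum (ip_set p)) i else x].

Definition ip_inv : 'S_n := (ip_perm p)^-1%g.

Definition ip_phi (x : 'I_n) : bool :=
  val x \in cvals (ip_perm p) (ip_set p).

Lemma size_cvals : size (cvals (ip_perm p) (ip_set p)) = k.
Proof. by rewrite size_map -cardE ip_card. Qed.

Lemma cval_lt (i j : nat) : i < j -> j < k -> cval i < cval j.
Proof.
move=> ij jk; have S := size_cvals.
by apply: (sorted_ltn_nth ltn_trans n (ip_incr p)); rewrite ?inE ?S //;
  apply: ltn_trans jk.
Qed.

Lemma cvalk : cval k = n.
Proof. by rewrite /cval nth_default ?size_cvals. Qed.

Lemma cval_le (i j : nat) : i <= j -> j <= k -> cval i <= cval j.
Proof.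
rewrite leq_eqVlt => /predU1P[->//|ij]; rewrite leq_eqVlt => /predU1P[ej|jk].
  rewrite ej cvalk /cval.
  have S := size_cvals.
  have ik : i < size (cvals (ip_perm p) (ip_set p)) by rewrite S -ej.
  have /mapP[a _ ->] := mem_nth n ik.
  exact: ltnW (ltn_ord _).
exact/ltnW/cval_lt.
Qed.

Lemma block_cover (x : 'I_n) : exists i : 'I_k, x \in block i.
Proof.
have k0 : 0 < k by have /andP[] := ip_deg p.
have ex : exists j, (j <= k) && (ip_perm p x < cval j).
  by exists k; rewrite leqnn cvalk ltn_ord.
case: (ex_minnP ex) => -[|j] /andP[jk lt_j] minj.
  by move: lt_j; rewrite /cval ip_first ltn0.
exists (Ordinal jk); rewrite inE /= lt_j andbT leqNgt.
by apply/negP => h; have := minj j; rewrite (ltnW jk) h ltnn => /(_ isT).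
Qed.

Lemma idem_mapE (i : 'I_k) (x : 'I_n) :
  x \in block i -> idem_map x = nth x (enum (ip_set p)) i.
Proof.
move=> xi; rewrite ffunE; case: pickP => [j xj|/(_ i)]; last by rewrite xi.
suff -> : j = i by [].
move: xi xj; rewrite !inE => /andP[l1 u1] /andP[l2 u2]; apply: val_inj => /=.
have key (a b : 'I_k) : a < b -> cval a.+1 <= cval b.
  by move=> ab; rewrite cval_le // ltnW.
case: (ltngtP j i) => // /key h.
  by have := leq_trans u2 (leq_trans h l1); rewrite ltnn.
by have := leq_trans u1 (leq_trans h l2); rewrite ltnn.
Qed.

End IdemPerm.

(** The index i - 1; the value at the least index is irrelevant. *)
Definition ord_prev (n : nat) (i : 'I_n) : 'I_n :=
  Ordinal (leq_ltn_trans (leq_pred i) (ltn_ord i)).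

(** * Unit-cost random access machine

    A machine has registers and an indirectly addressed memory, all holding
    natural numbers.  Executing any instruction costs one time unit. *)

Inductive instr : Type :=
  | Const of nat & nat          (* Const r v   : R[r] := v *)
  | Plus of nat & nat & nat     (* Plus r a b  : R[r] := R[a] + R[b] *)
  | Minus of nat & nat & nat    (* Minus r a b : R[r] := R[a] - R[b], truncated *)
  | Read of nat & nat           (* Read r a    : R[r] := M[R[a]] *)
  | Write of nat & nat          (* Write a r   : M[R[a]] := R[r] *)
  | Jump of nat                 (* Jump l      : continue at instruction l *)
  | JumpZ of nat & nat.         (* JumpZ r l   : the same, if R[r] = 0 *)

Record state : Type := State {
  pc : nat;
  regs : nat -> nat;
  cells : nat -> nat
}.

Definition upd (f : nat -> nat) (a v : nat) : nat -> nat :=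
  fun b => if b == a then v else f b.

Definition exec (ins : instr) (s : state) : state :=
  let: State l R M := s in
  match ins with
  | Const r v => State l.+1 (upd R r v) M
  | Plus r a b => State l.+1 (upd R r (R a + R b)) M
  | Minus r a b => State l.+1 (upd R r (R a - R b)) M
  | Read r a => State l.+1 (upd R r (M (R a))) M
  | Write a r => State l.+1 R (upd M (R a) (R r))
  | Jump l' => State l' R M
  | JumpZ r l' => State (if R r == 0 then l' else l.+1) R M
  end.

(** The machine halts when the program counter leaves the program. *)
Definition halted (prog : seq instr) (s : state) : bool := size prog <= pc s.

Definition step (prog : seq instr) (s : state) : state :=
  if onth prog (pc s) is Some ins then exec ins s else s.

Definition run (prog : seq instr) (t : nat) (s : state) : state :=
  iter t (step prog) s.

(** Input: R[0] = n, M[i] = pi^-(i) and M[n + i] = phi^-(i) for 1 <= i <= n, all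
    other cells being 0.  The numbers are those of {1, ..., n}, whence [.+1]. *)
Definition input (n k : nat) (p : idem_perm n k) : state :=
  State 0
    (fun r => if r == 0 then n else 0)
    (nth 0 (0 :: [seq (ip_inv p i).+1 | i <- enum 'I_n]
              ++ [seq nat_of_bool (ip_phi p i) | i <- enum 'I_n])).

(** The output array: iota(x) is to be stored in M[2n + x] for 1 <= x <= n, and an
    entry 0 means that the value is not yet determined. *)
Definition output (n : nat) (s : state) (x : 'I_n) : nat := cells s (n.*2 + x.+1).

(** [prog] fills the output array with the values of [iota] successively at
    pi^-(1), ..., pi^-(n), and halts, within [T] steps: at time [tm i] exactly the
    first [i] values have been determined. *)
Definition evaluates_successively (n k : nat) (prog : seq instr)
    (p : idem_perm n k) (iota : 'I_n -> 'I_n) (T : nat) : Prop :=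
  exists tm : nat -> nat,
    [/\ {homo tm : i j / i <= j},
        forall i : nat, i <= n -> forall j : 'I_n,
          output (run prog (tm i) (input p)) (ip_inv p j)
            = if j < i then (iota (ip_inv p j)).+1 else 0,
        halted prog (run prog (tm n) (input p))
      & tm n <= T].

(* Main.v *)
(** The classes [a_i]_pi are the preimages under pi of the consecutive intervals
    [c_i, c_(i+1)), so iota o pi^- is constant on each of these intervals, with
    value a_i = pi^-(c_i) at its left end; the recurrence says just this.  As
    phi^- holds at the least index, the recurrence also determines iota.  A
    machine evaluates it in one pass over the input, keeping the last value of
    iota in a register. *)
Require Import Defs.
From mathcomp Require Import all_boot all_order all_fingroup.
From mathcomp Require Import zify.

Set Implicit Arguments.
Unset Strict Implicit.
Unset Printing Implicit Defensive.

(** * The recurrence and its unique solution *)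

Section Recurrence.
Variables (n k : nat) (p : idem_perm n k).

Lemma cval_nth (x : 'I_n) (i : nat) :
  i < k -> cval p i = ip_perm p (nth x (enum (ip_set p)) i).
Proof. by move=> ik; rewrite /cval (nth_map x) // -cardE ip_card. Qed.

Lemma idem_map_mem (x : 'I_n) : idem_map p x \in ip_set p.
Proof.
have [i xi] := block_cover p x.
by rewrite (idem_mapE xi) -mem_enum mem_nth // -cardE ip_card.
Qed.

(** The value of [a] under pi is the left end of an interval, and the index of that interval is the
    position of [a] in the increasing list of A. *)
Lemma idem_map_fix (a : 'I_n) : a \in ip_set p -> idem_map p a = a.
Proof.
move=> aA; have ia : index a (enum (ip_set p)) < k.
  by rewrite -[X in _ < X](ip_card p) cardE index_mem mem_enum.
have nth_a : nth a (enum (ip_set p)) (index a (enum (ip_set p))) = a.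
  by rewrite nth_index ?mem_enum.
have ca : cval p (index a (enum (ip_set p))) = ip_perm p a.
  by rewrite (cval_nth a ia) nth_a.
have ba : a \in block p (Ordinal ia).
  rewrite inE /= -ca leqnn /=.
  (* In the last class the upper bound is the convention [cval p k = n]. *)
  have := ia; rewrite leq_eqVlt => /predU1P[e|]; last exact: cval_lt.
  by rewrite e cvalk ca ltn_ord.
by rewrite (idem_mapE ba) nth_a.
Qed.

Lemma idem_map_in_idem_maps : idem_map p \in idem_maps n k.
Proof.
rewrite inE; apply/andP; split.
  by apply/forallP => x; rewrite (idem_map_fix (idem_map_mem x)).
rewrite -[X in _ == X](ip_card p); apply/eqP; congr #|pred_of_set _|.
apply/setP => a; apply/imsetP/idP => [[x _ ->]|aA]; first exact: idem_map_mem.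
by exists a; rewrite ?idem_map_fix.
Qed.

Lemma ip_phiE (i : 'I_n) : ip_phi p i = (ip_inv p i \in ip_set p).
Proof.
rewrite /ip_phi /cvals map_comp (mem_map val_inj).
by rewrite -{1}(permKV (ip_perm p) i) (mem_map perm_inj) mem_enum.
Qed.

Lemma ip_phi0 (i : 'I_n) : i = 0 :> nat -> ip_phi p i.
Proof.
move=> i0; have /andP[k0 _] := ip_deg p.
by rewrite /ip_phi /= i0 -[X in X \in _](ip_first p) mem_nth // size_cvals.
Qed.

Lemma idem_map_rec (i : 'I_n) :
  idem_map p (ip_inv p i)
    = if ip_phi p i then ip_inv p i else idem_map p (ip_inv p (ord_prev i)).
Proof.
case: ifPn => [|phi_i]; first by rewrite ip_phiE => /idem_map_fix.
have [j xj] := block_cover p (ip_inv p i).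
have cj : cval p j != i.
  apply: contraNneq phi_i => cj.
  by rewrite /ip_phi /= -cj mem_nth // size_cvals.
(* As i is not the left end of its interval, i - 1 lies in the same interval. *)
have yj : ip_inv p (ord_prev i) \in block p j.
  move: xj; rewrite !inE /ip_inv !permKV /=; lia.
(* Only the default values of the two [nth] differ, and the index is in range. *)
by rewrite (idem_mapE xj) (idem_mapE yj); apply: set_nth_default;
  rewrite -cardE ip_card.
Qed.

(** Strong induction on i = pi(x): the second case of the recurrence cannot occur at the least
    index, so it always refers to a smaller one. *)
Lemma rec_unique (f g : {ffun 'I_n -> 'I_n}) :
  (forall i, f (ip_inv p i)
     = if ip_phi p i then ip_inv p i else f (ip_inv p (ord_prev i))) ->
  (forall i, g (ip_inv p i)
     = if ip_phi p i then ip_inv p i else g (ip_inv p (ord_prev i))) ->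
  f = g.
Proof.
move=> Hf Hg; apply/ffunP => x.
rewrite -(permK (ip_perm p) x) -/(ip_inv p); move: (ip_perm p x) => i.
have [m] := ubnP i; elim: m i => // m IH i im.
rewrite Hf Hg; case: ifPn => // phi_i; apply: IH => /=.
have : i != 0 :> nat by apply: contraNneq phi_i => /ip_phi0.
lia.
Qed.

End Recurrence.

(** * The program and one passage through its loop *)

(** R[0] = n, R[1] = i, R[2] is the last value of iota, R[3] = 1 and R[8] = 0.
    The instructions at 8 and 9 do nothing; they make both branches equally long,
    so that every passage through the loop takes 13 steps (the 13th step of the
    last passage is an idle one, after halting). *)
Definition iota_prog : seq instr :=
  [:: Const 3 1;
      Plus 1 1 3;
      Read 5 1;
      Plus 7 0 1;
      Read 6 7;
      JumpZ 6 8;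
      Plus 2 5 8;
      Jump 10;
      Plus 8 8 8;
      Jump 10;
      Plus 7 0 5;
      Plus 7 7 0;
      Write 7 2;
      Minus 4 0 1;
      JumpZ 4 16;
      Jump 1].

Lemma run_step (prog : seq instr) (t : nat) (s : state) :
  run prog t.+1 s
    = run prog t (if onth prog (pc s) is Some ins then exec ins s else s).
Proof. exact: iterSr. Qed.

Lemma run_add (prog : seq instr) (t u : nat) (s : state) :
  run prog (t + u) s = run prog t (run prog u s).
Proof. exact: iterD. Qed.

Local Arguments run : simpl never.
Local Arguments upd : simpl never.

Lemma iota_prog_loop (R M : nat -> nat) : R 3 = 1 -> R 8 = 0 ->
  let i := (R 1).+1 in
  let v := if M (R 0 + i) == 0 then R 2 else M i in
  let s := run iota_prog 13 (State 1 R M) in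
  [/\ pc s = if R 0 <= i then 16 else 1,
      [/\ regs s 0 = R 0, regs s 1 = i, regs s 2 = v, regs s 3 = 1
        & regs s 8 = 0]
    & cells s = upd M (R 0 + M i + R 0) v].
Proof.
move=> R3 R8 i v s; have Ri : R 1 + R 3 = i by rewrite R3 addn1.
have updE f a w b : upd f a w b = if b == a then w else f b by [].
rewrite {}/v; move Es: s => s'; rewrite {}/s in Es.
(* Five instructions lead up to and including the test of phi^-. *)
do 5 rewrite run_step /= ?updE /= ?Ri in Es.
(* Either branch takes seven more, ending with the exit test; the thirteenth step jumps back or
   idles. *)
by case: (M (R 0 + i) == 0) Es => Es;
  do 7 rewrite run_step /= ?updE /= ?Ri in Es;
  rewrite subn_eq0 in Es; case: (R 0 <= i) Es => Es;
  rewrite run_step /= in Es; rewrite -Es /run /= !updE /= ?R8 ?addn0.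
Qed.

(** * Correctness and running time *)

Section Evaluation.
Variables (n k : nat) (p : idem_perm n k) (f : 'I_n -> 'I_n).
Hypothesis f_rec : forall i, f (ip_inv p i)
  = if ip_phi p i then ip_inv p i else f (ip_inv p (ord_prev i)).

Lemma input_inv (i : 'I_n) : cells (input p) i.+1 = (ip_inv p i).+1.
Proof.
rewrite /= nth_cat size_map size_enum_ord ltn_ord.
by rewrite (nth_map i) ?size_enum_ord // nth_ord_enum.
Qed.

Lemma input_phi (i : 'I_n) : cells (input p) (n + i.+1) = ip_phi p i.
Proof.
rewrite addnS /= nth_cat size_map size_enum_ord ltnNge leq_addr /= addKn.
by rewrite (nth_map i) ?size_enum_ord // nth_ord_enum.
Qed.

Lemma input_output (x : 'I_n) : output (input p) x = 0.
Proof.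
rewrite /output addnS /= nth_default // size_cat 2!size_map size_enum_ord.
by rewrite -addnn leq_addr.
Qed.

(** The loop invariant. The input occupies addresses up to 2n and must survive, since later passes
    read it; the clause on R[2] is vacuous before the first pass. *)
Definition evaluated (i : nat) (s : state) : Prop :=
  [/\ pc s = if n <= i then 16 else 1,
      [/\ regs s 0 = n, regs s 1 = i, regs s 3 = 1 & regs s 8 = 0],
      (forall j : 'I_n, j.+1 = i -> regs s 2 = (f (ip_inv p j)).+1),
      (forall a, a <= n.*2 -> cells s a = cells (input p) a)
    & (forall j : 'I_n, output s (ip_inv p j)
         = if j < i then (f (ip_inv p j)).+1 else 0)].

Lemma evaluated0 : evaluated 0 (run iota_prog 1 (input p)).
Proof.
have /andP[k0 kn] := ip_deg p.
split=> //= [|j]; last exact: input_output.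
by rewrite leqNgt (leq_trans k0 kn).
Qed.

Lemma evaluatedS (i : nat) (s : state) :
  i < n -> evaluated i s -> evaluated i.+1 (run iota_prog 13 s).
Proof.
case: s => l R M lt_in [/= ->]; rewrite leqNgt lt_in /=.
case=> R0 R1 R3 R8 R2 cellsM outM.
have := iota_prog_loop M R3 R8; cbv zeta; rewrite R0 R1.
pose o := Ordinal lt_in; have le_2n : n + i.+1 <= n.*2 by lia.
have -> : M (n + i.+1) = ip_phi p o.
  by rewrite cellsM //; exact: (input_phi o).
have -> : M i.+1 = (ip_inv p o).+1.
  by rewrite cellsM; [exact: (input_inv o)|lia].
set v := (if _ == 0 then _ else _); have -> : v = (f (ip_inv p o)).+1.
  (* If phi^- vanishes here, the index is positive, so R[2] holds the value of [f] from the previous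
     pass. *)
  rewrite /v f_rec; case: (boolP (ip_phi p o)) => //= phi_o.
  rewrite (R2 (ord_prev o)) //=.
  have : i != 0 by apply: contraNneq phi_o => i0; apply: ip_phi0.
  lia.
case: (run _ _ _) => l' R' M' /= [-> [R'0 R'1 R'2 R'3 R'8] ->].
split=> //= [j [ji]|a le_a|j].
- by rewrite R'2; congr (f (ip_inv p _)).+1; apply: val_inj.
- by rewrite /upd ifN ?cellsM //; lia.
rewrite /output /= /upd.
(* By injectivity of pi^-, the write changes the output entry of index [o] only. *)
have -> : (n.*2 + (ip_inv p j).+1 == n + (ip_inv p o).+1 + n) = (j == o).
  rewrite -(inj_eq (perm_inj (s:=ip_inv p))) -val_eqE /=; lia.
case: eqP => [->|/eqP jo]; first by rewrite /= ltnSn.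
have ji : j != i :> nat by rewrite -[i]/(val o) val_eqE.
have := outM j; rewrite /output /= => ->; congr (if _ then _ else _); lia.
Qed.

Lemma evaluatedP (i : nat) :
  i <= n -> evaluated i (run iota_prog (13 * i + 1) (input p)).
Proof.
elim: i => [|i IH] lt_in; first exact: evaluated0.
rewrite mulnS -addnA run_add.
exact: (evaluatedS lt_in (IH (ltnW lt_in))).
Qed.

Lemma iota_prog_evaluates : evaluates_successively iota_prog p f (14 * n).
Proof.
(* One initial step and 13 per pass; 13n + 1 is at most 14n because n is positive. *)
exists (fun i => 13 * i + 1); split=> [i j|i le_in|| ].
- lia.
- by have [] := evaluatedP le_in.
- by have [pcE] := evaluatedP (leqnn n); rewrite /halted pcE leqnn.
- have := ip_deg p; lia.
Qed.

End Evaluation.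

Theorem theorem3p14 :
  exists (prog : seq instr) (C : nat),
    forall (n k : nat) (p : idem_perm n k),
      [/\ idem_map p \in idem_maps n k,
          (forall i : 'I_n,
             idem_map p (ip_inv p i)
               = if ip_phi p i then ip_inv p i
                 else idem_map p (ip_inv p (ord_prev i))),
          (forall f : {ffun 'I_n -> 'I_n},
             (forall i : 'I_n,
                f (ip_inv p i)
                  = if ip_phi p i then ip_inv p i
                    else f (ip_inv p (ord_prev i))) ->
             f = idem_map p)
        & evaluates_successively prog p (idem_map p) (C * n)].
Proof.
exists iota_prog, 14 => n k p; split.
- exact: idem_map_in_idem_maps.
- exact: idem_map_rec.
- by move=> f f_rec; apply: rec_unique f_rec (idem_map_rec p).
- exact: iota_prog_evaluates (idem_map_rec p).
Qed.
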